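(* Let $u\in X$ be the unique solution of $A(u,v)=0$ for all $v\in X$, let $u_h^0\in X_h$ be an arbitrary initial guess, and let $u_h^n\in X_h$, $n\ge 1$, be the iterates defined by $$(u_h^{n},v)_X=(u_h^{n-1},v)_X-\frac{c_0}{L^2}A(u_h^{n-1},v)\qquad\forall v\in X_h .$$ Then, for any $n\ge 1$, $$\|u-u_h^{n}\|_X\le \frac{L}{c_0}\inf_{v\in X_h}\|u-v\|_X+\frac{k^n}{1-k}\,\|u_h^{0}-u_h^{1}\|_{X},\qquad\text{where } k=\sqrt{1-\left(\frac{c_0}{L}\right)^2}.$$
   Context: $X$ is a real Hilbert space with inner product $(\cdot,\cdot)_X$ and induced norm $\|\cdot\|_X$. $X_h\subseteq X$ is a finite dimensional linear subspace. $A:X\times X\to\mathbb{R}$ is a (possibly nonlinear) form such that for any $u\in X$ the mapping $v\mapsto A(u,v)$ is linear and bounded. It is assumed that there are constants $c_0>0$ and $L>0$ with (strong monotonicity) $A(u,u-v)-A(v,u-v)\ge c_0\|u-v\|_X^2$ for all $u,v\in X$, and (Lipschitz continuity) $|A(u,w)-A(v,w)|\le L\|u-v\|_X\|w\|_X$ for all $u,v,w\in X$. Under these assumptions there is a unique $u\in X$ with $A(u,v)=0$ for all $v\in X$. *)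

(* Defs.v *)
From mathcomp Require Import all_boot all_order all_algebra.
From mathcomp Require Import all_classical all_reals all_analysis.

Set Implicit Arguments.
Unset Strict Implicit.
Unset Printing Implicit Defensive.

Import Order.TTheory GRing.Theory Num.Theory.
Import numFieldNormedType.Exports.

Local Open Scope classical_set_scope.
Local Open Scope ring_scope.

(* A [completeNormedModType] together with a dot product satisfying this
   predicate is a real Hilbert space: completeness then refers to the norm
   induced by the inner product. *)
Definition induces_norm (R : realType) (X : completeNormedModType R)
    (dot : {dot X for idfun}) : Prop :=
  forall x : X, `|x| = Num.sqrt (dot x x).

(* The vectors [b i] need not be independent: a finite spanning family is
   enough, and [n = 0] gives the zero subspace. *)
Definition finite_dim (R : realType) (X : lmodType R) (S : {pred X}) : Prop :=
  exists (n : nat) (b : 'I_n -> X), forall x : X,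
    x \in S <-> exists c : 'I_n -> R, x = \sum_(i < n) c i *: b i.

Definition bounded_functional (R : realType) (X : normedModType R)
    (f : X -> R) : Prop :=
  exists M : R, forall v : X, `|f v| <= M * `|v|.

Definition strongly_monotone (R : realType) (X : normedModType R)
    (A : X -> X -> R) (c0 : R) : Prop :=
  forall u v : X, c0 * `|u - v| ^+ 2 <= A u (u - v) - A v (u - v).

Definition lipschitz_form (R : realType) (X : normedModType R)
    (A : X -> X -> R) (L : R) : Prop :=
  forall u v w : X, `|A u w - A v w| <= L * `|u - v| * `|w|.

(* Main.v *)
Require Import Defs.
From mathcomp Require Import all_boot all_order all_algebra.
From mathcomp Require Import all_classical all_reals all_analysis.
From mathcomp Require Import ring lra.

(** Three facts carry the estimate; write $e_m = \|u_h^m - u_h^{m+1}\|$.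

    Contraction.  If $p', q' \in X_h$ are obtained from $p, q \in X_h$ by one
    step, then $g = (p - q) - (p' - q')$ represents
    $v \mapsto (c_0/L^2)(A(p,v) - A(q,v))$ on $X_h$, so Lipschitz continuity
    bounds $\|g\|$ and strong monotonicity bounds $(p - q, g)_X$ from below;
    expanding $\|(p - q) - g\|^2$ gives $\|p' - q'\| \le k \|p - q\|$
    ([galerkin_step_contraction]).

    Geometric series.  Hence $e_m \le k^m e_0$ ([geometric_decay]), and
    $\|u_h^n - u_h^m\| \le k^n/(1-k)\, e_0$ for $m \ge n$
    ([geometric_tail]).

    Perturbed quasi-optimality.  The iterate $u_h^m$ solves the Galerkin
    equations up to the residual $A(u_h^m, \cdot) = (L^2/c_0)
    (u_h^m - u_h^{m+1}, \cdot)_X$ on $X_h$, so the proof of Cea's lemma yields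
    $c_0 \|u - u_h^m\|^2 \le L \|u - u_h^m\| \|u - v\|
      + (L^2/c_0)\, e_m (\|u - u_h^m\| + \|u - v\|)$ for every $v \in X_h$
    ([cea_with_residual]).

    The usual argument passes through the Galerkin solution, the limit of the
    iterates.  The limit can instead be taken in the scalar inequality: were
    the claimed bound violated at $n$ for some $v$ by $s > 0$, the second fact
    would force $\|u - u_h^m\| \ge (L/c_0) \|u - v\| + s$ for all $m \ge n$,
    and the third would keep $c_0 s$ below a multiple of $k^m$, which tends
    to 0 ([le_of_vanishing_perturbation]). *)

Import Order.TTheory GRing.Theory Num.Theory.
Import numFieldNormedType.Exports.

Local Open Scope classical_set_scope.
Local Open Scope ring_scope.

Lemma scalarBr (R : pzRingType) (X : lmodType R) (f : X -> R) :
  scalar f -> forall x y : X, f (x - y) = f x - f y.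
Proof.
by move=> lf x y; rewrite addrC -scaleN1r lf mulN1r addrC.
Qed.

Lemma submodB (R : pzRingType) (X : lmodType R) (S : submodClosed X) (x y : X) :
  x \in S -> y \in S -> x - y \in S.
Proof. by move=> xS yS; rewrite -scaleN1r rpredD ?rpredZ. Qed.

(** * Inner products *)

Lemma dotBl (R : realType) (X : lmodType R) (dot : {dot X for idfun})
  (x y z : X) : dot (x - y) z = dot x z - dot y z.
Proof. exact: linearBl. Qed.

Lemma dotBr (R : realType) (X : lmodType R) (dot : {dot X for idfun})
  (x y z : X) : dot z (x - y) = dot z x - dot z y.
Proof. exact: linearBr. Qed.

Lemma dot_diag (R : realType) (X : completeNormedModType R)
    (dot : {dot X for idfun}) (x : X) :
  induces_norm dot -> dot x x = `|x| ^+ 2.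
Proof.
move=> hdot; rewrite hdot sqr_sqrtr //.
by have [->|x0] := eqVneq x 0; [rewrite linear0l | exact/ltW/neq0_dnorm_gt0].
Qed.

Lemma dot_sym (R : realType) (X : lmodType R) (dot : {dot X for idfun})
  (x y : X) : dot x y = dot y x.
Proof. by rewrite hermC expr0 mul1r. Qed.

Lemma sqr_norm_sub (R : realType) (X : completeNormedModType R)
    (dot : {dot X for idfun}) (x y : X) :
  induces_norm dot -> `|x - y| ^+ 2 = `|x| ^+ 2 - 2 * dot x y + `|y| ^+ 2.
Proof.
move=> hdot.
rewrite -!(dot_diag _ _ _ _ hdot).
by rewrite dotBl !dotBr (dot_sym _ _ _ y x); ring.
Qed.

(** Cauchy-Schwarz by polarization: since the norm is already known to satisfy
    the triangle inequality, $(\|x\| - \|y\|)^2 \le \|x - y\|^2$ suffices. *)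
Lemma dot_le_norm (R : realType) (X : completeNormedModType R)
    (dot : {dot X for idfun}) (x y : X) :
  induces_norm dot -> dot x y <= `|x| * `|y|.
Proof.
move=> hdot.
have : (`|x| - `|y|) ^+ 2 <= `|x - y| ^+ 2.
  by rewrite -real_normK ?num_real // lerXn2r ?nnegrE // ler_dist_dist.
by rewrite (sqr_norm_sub _ _ _ _ _ hdot); nra.
Qed.

(** * The Galerkin fixed-point step *)

(** On $X_h$, [g] is the Riesz representative of the increment of $A$ scaled by
    $c_0/L^2$; this step size minimizes the factor
    $1 - 2 \tau c_0 + \tau^2 L^2$ over $\tau$. *)
Lemma galerkin_step_contraction (R : realType) (X : completeNormedModType R)
    (dot : {dot X for idfun}) (Xh : submodClosed X)
    (A : X -> X -> R) (c0 L : R) (p q p' q' : X) :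
  induces_norm dot -> 0 < c0 -> 0 < L ->
  (forall w : X, scalar (A w)) ->
  strongly_monotone A c0 -> lipschitz_form A L ->
  p \in Xh -> q \in Xh -> p' \in Xh -> q' \in Xh ->
  (forall v, v \in Xh -> dot p' v = dot p v - c0 / L ^+ 2 * A p v) ->
  (forall v, v \in Xh -> dot q' v = dot q v - c0 / L ^+ 2 * A q v) ->
  `|p' - q'| <= Num.sqrt (1 - (c0 / L) ^+ 2) * `|p - q|.
Proof.
move=> hdot c0_gt0 L_gt0 Alin Amon Alip pX qX p'X q'X stepp stepq.
pose g := (p - q) - (p' - q').
set t := c0 / L ^+ 2 in stepp stepq *.
have tE : t = c0 / L ^+ 2 by [].
have t_gt0 : 0 < t by rewrite divr_gt0 // exprn_gt0.
clearbody t.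
have tL_ge0 : 0 <= t * L by apply: mulr_ge0; exact: ltW.
have gX : g \in Xh by do ![apply: submodB | done].
have gE v : v \in Xh -> dot g v = t * (A p v - A q v).
  by move=> vX; rewrite /g !dotBl (stepp v vX) (stepq v vX); ring.
have g_le : `|g| <= t * L * `|p - q|.
  have [->|g_neq0] := eqVneq g 0.
    by rewrite normr0 mulr_ge0.
  have g_gt0 : 0 < `|g| by rewrite normr_gt0.
  rewrite -(ler_pM2r g_gt0) -expr2 -(dot_diag _ _ _ _ hdot) gE //.
  rewrite -!mulrA ler_pM2l // mulrA.
  exact: le_trans (ler_norm _) (Alip _ _ _).
have g_ge : t * c0 * `|p - q| ^+ 2 <= dot (p - q) g.
  by rewrite dot_sym gE ?submodB // -mulrA ler_pM2l.
have g2_le : `|g| ^+ 2 <= (t * L) ^+ 2 * `|p - q| ^+ 2.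
  by rewrite -exprMn lerXn2r ?nnegrE // mulr_ge0.
have tc0 : t * c0 = (c0 / L) ^+ 2 by rewrite tE; field; lra.
have tL : (t * L) ^+ 2 = (c0 / L) ^+ 2 by rewrite tE; field; lra.
have sq_le : `|p' - q'| ^+ 2 <= `|p - q| ^+ 2 * (1 - (c0 / L) ^+ 2).
  have -> : p' - q' = (p - q) - g by rewrite /g subKr.
  rewrite (sqr_norm_sub _ _ _ _ _ hdot).
  by move: g_ge g2_le; rewrite tc0 tL; lra.
rewrite -(normr_id (p' - q')) -(normr_id (p - q)) -!sqrtr_sqr.
by rewrite mulrC -sqrtrM ?sqr_ge0 // ler_wsqrtr.
Qed.

(** Cea's argument with a residual: $A(p,\cdot)$ need not vanish on $X_h$, but
    it is represented there by $(L^2/c_0)(p - p')$, and $v - p \in X_h$. *)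
Lemma cea_with_residual (R : realType) (X : completeNormedModType R)
    (dot : {dot X for idfun}) (Xh : submodClosed X)
    (A : X -> X -> R) (c0 L : R) (u p p' v : X) :
  induces_norm dot -> 0 < c0 -> 0 < L ->
  (forall w : X, scalar (A w)) ->
  strongly_monotone A c0 -> lipschitz_form A L ->
  (forall w : X, A u w = 0) ->
  p \in Xh -> v \in Xh ->
  (forall w, w \in Xh -> dot p' w = dot p w - c0 / L ^+ 2 * A p w) ->
  c0 * `|u - p| ^+ 2 <= L * `|u - p| * `|u - v|
    + L ^+ 2 / c0 * `|p - p'| * (`|u - p| + `|u - v|).
Proof.
move=> hdot c0_gt0 L_gt0 Alin Amon Alip Au pX vX stepp.
have res : A p (p - v) = L ^+ 2 / c0 * dot (p - p') (p - v).
  rewrite dotBl (stepp (p - v)) ?submodB //; field.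
  by rewrite !gt_eqF.
have split_err : A u (u - p) - A p (u - p)
    = (A u (u - v) - A p (u - v)) + A p (p - v).
  by rewrite !Au !sub0r !(scalarBr _ _ _ (Alin p)); ring.
apply: (le_trans (Amon u p)); rewrite split_err lerD //.
  exact: le_trans (ler_norm _) (Alip _ _ _).
have f_gt0 : 0 < L ^+ 2 / c0 by rewrite divr_gt0 // exprn_gt0.
rewrite res -[leRHS]mulrA ler_pM2l //.
apply: (le_trans (dot_le_norm _ _ _ _ _ hdot)).
rewrite ler_wpM2l // (distrC u p).
have -> : p - v = (p - u) + (u - v) by rewrite addrA subrK.
exact: ler_normD.
Qed.

(** * Geometric sequences of increments *)

Lemma geometric_decay (R : realType) (e : nat -> R) (k : R) :
  0 <= k -> (forall n, e n.+1 <= k * e n) -> forall n, e n <= k ^+ n * e 0%N.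
Proof.
move=> k_ge0 ek; elim=> [|n IHn]; first by rewrite expr0 mul1r.
by rewrite exprS -mulrA (le_trans (ek n)) // ler_wpM2l.
Qed.

(** The claimed bound is not inductive in [m]; the exact partial sum
    $(k^n - k^m)/(1-k)$ of the geometric series is. *)
Lemma geometric_tail (R : realType) (X : normedModType R) (x : nat -> X)
    (k : R) :
  0 <= k -> k < 1 ->
  (forall n, `|x n.+1 - x n.+2| <= k * `|x n - x n.+1|) ->
  forall n m, (n <= m)%N ->
  `|x n - x m| <= k ^+ n / (1 - k) * `|x 0%N - x 1%N|.
Proof.
move=> k_ge0 k_lt1 xk n m nm; rewrite -(subnKC nm).
have decay := geometric_decay _ (fun i => `|x i - x i.+1|) _ k_ge0 xk.
have k1 : 0 < 1 - k by rewrite subr_gt0.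
have partial j : `|x n - x (n + j)%N|
    <= (k ^+ n - k ^+ (n + j)) / (1 - k) * `|x 0%N - x 1%N|.
  elim: j => [|j IHj]; first by rewrite addn0 !subrr !mul0r normr0.
  rewrite addnS (le_trans (ler_distD (x (n + j)%N) _ _)) //.
  rewrite (le_trans (lerD IHj (decay _))) // -mulrDl ler_wpM2r //.
  rewrite le_eqVlt; apply/orP; left; apply/eqP.
  by rewrite exprS; field; rewrite gt_eqF.
apply: (le_trans (partial _)).
by rewrite ler_wpM2r // ler_pM2r ?invr_gt0 // gerBl exprn_ge0.
Qed.

(** * Passage to the limit *)

(** If $a > (L/c) d$, then $a_m \ge a$ makes $d \le (c/L) a_m$ and $a_m > 0$, so
    the quadratic inequality can be divided by $a_m$ and leaves
    $c (a - (L/c) d) \le B (1 + c/L) k^m$ for all $m \ge n$, whose right-hand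
    side tends to 0. *)
Lemma le_of_vanishing_perturbation (R : realType) (am : nat -> R)
    (a d c L B k : R) (n : nat) :
  0 < c -> 0 < L -> 0 <= d -> 0 <= B -> 0 <= k -> k < 1 ->
  (forall m, (n <= m)%N -> a <= am m) ->
  (forall m, c * am m ^+ 2 <= L * am m * d + B * k ^+ m * (am m + d)) ->
  a <= L / c * d.
Proof.
move=> c_gt0 L_gt0 d_ge0 B_ge0 k_ge0 k_lt1 a_le quad.
rewrite leNgt; apply/negP => lt_a.
pose s := a - L / c * d; pose D := B * (1 + c / L).
have s_gt0 : 0 < s by rewrite subr_gt0.
have Ld_ge0 : 0 <= L / c * d by rewrite mulr_ge0 // divr_ge0 // ltW.
have below m : (n <= m)%N -> c * s <= D * k ^+ m.
  move=> /a_le a_le_m.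
  have am_gt0 : 0 < am m by lra.
  have d_le : d <= c / L * am m.
    have -> : d = c / L * (L / c * d) by field; lra.
    by rewrite ler_pM2l ?divr_gt0 //; lra.
  have gap : c * s * am m <= c * am m ^+ 2 - L * am m * d.
    have -> : c * am m ^+ 2 - L * am m * d = c * (am m - L / c * d) * am m.
      by field; lra.
    by rewrite ler_pM2r // ler_pM2l // lerB.
  rewrite -(ler_pM2r am_gt0); apply: (le_trans gap).
  rewrite lerBlDl (le_trans (quad m)) // lerD2l.
  have -> : D * k ^+ m * am m = B * k ^+ m * (am m + c / L * am m).
    by rewrite /D; ring.
  by rewrite ler_wpM2l ?mulr_ge0 ?exprn_ge0 // lerD2l.
have lim0 : D * k ^+ m @[m --> \oo] --> 0.
  rewrite -[X in _ --> X](mulr0 D); apply: cvgMr.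
  by apply: cvg_expr; rewrite ger0_norm.
have small : \forall m \near \oo, D * k ^+ m < c * s.
  by apply: cvgr_lt lim0 _ _; rewrite mulr_gt0.
have [m [lt_m n_m]] := filter_ex (filterI small (nbhs_infty_ge n)).
by have := below m n_m; rewrite leNgt lt_m.
Qed.

Theorem proposition2p2 (R : realType) (X : completeNormedModType R)
    (dot : {dot X for idfun}) (Xh : submodClosed X)
    (A : X -> X -> R) (c0 L : R) (u : X) (uh : nat -> X)
    (k := Num.sqrt (1 - (c0 / L) ^+ 2)) :
  induces_norm dot ->
  finite_dim Xh ->
  (forall w : X, scalar (A w)) ->
  (forall w : X, bounded_functional (A w)) ->
  0 < c0 -> 0 < L ->
  strongly_monotone A c0 ->
  lipschitz_form A L ->
  (forall v : X, A u v = 0) ->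
  (forall n : nat, uh n \in Xh) ->
  (forall n : nat, (1 <= n)%N -> forall v : X, v \in Xh ->
     dot (uh n) v = dot (uh n.-1) v - c0 / L ^+ 2 * A (uh n.-1) v) ->
  forall n : nat, (1 <= n)%N ->
    `|u - uh n| <= L / c0 * inf [set `|u - v| | v in [set` Xh]]
                   + k ^+ n / (1 - k) * `|uh 0%N - uh 1%N|.
Proof.
move=> hdot _ Alin _ c0_gt0 L_gt0 Amon Alip Au uhX step n _.
have k_ge0 : 0 <= k by rewrite sqrtr_ge0.
have k_lt1 : k < 1.
  by rewrite /k -[ltRHS]sqrtr1 ltr_sqrt // gtrBl exprn_gt0 // divr_gt0.
have stepS m v (vX : v \in Xh) := step m.+1 isT v vX.
have contr m : `|uh m.+1 - uh m.+2| <= k * `|uh m - uh m.+1|.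
  by apply: (galerkin_step_contraction _ _ dot Xh A); rewrite ?uhX //=;
     exact: stepS.
rewrite -lerBlDr -ler_pdivrMl ?divr_gt0 //.
apply: lb_le_inf; first by exists `|u - 0|, 0; rewrite //= rpred0.
move=> _ [v /= vX <-]; rewrite ler_pdivrMl ?divr_gt0 //.
apply: (@le_of_vanishing_perturbation _ (fun m => `|u - uh m|) _ _ _ _
          (L ^+ 2 / c0 * `|uh 0%N - uh 1%N|) k n) => //.
- by rewrite mulr_ge0 // divr_ge0 ?sqr_ge0 // ltW.
- move=> m nm; rewrite lerBlDr.
  rewrite (le_trans (ler_distD (uh m) _ _)) // lerD2l distrC.
  exact: geometric_tail.
- move=> m.
  have := @cea_with_residual _ _ dot Xh A c0 L u (uh m) (uh m.+1) v hdot
    c0_gt0 L_gt0 Alin Amon Alip Au (uhX m) vX (stepS m).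
  move/le_trans; apply; rewrite lerD2l ler_wpM2r ?addr_ge0 //.
  rewrite -[leRHS]mulrA ler_pM2l ?divr_gt0 ?exprn_gt0 // mulrC.
  by rewrite (geometric_decay _ (fun i => `|uh i - uh i.+1|)).
Qed.
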